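(* Let $\mathbb{K}$ be a field of characteristic $0$. For every integer $d\geq 2$ with $d\neq 2,4$ (that is, $d=3$ or $d\geq5$), there exists a $d$-quadratic family $\{A_1,\dots,A_d\}$ of $d\times d$ matrices over $\mathbb{K}$.
   Context: $d$-quadratic family: for $d\geq2$, an indexed family $\{A_1,\dots,A_d\}$ of $d\times d$ matrices over $\mathbb{K}$ is $d$-quadratic if: (1) every $A_i$ is skewsymmetric ($A_i^t=-A_i$); (2) the $i$-th column of $A_i$ is zero, for every $i$; (3) for all $j>i$, the $j$-th column of $A_i$ is the additive inverse of the $i$-th column of $A_j$; (4) if $B_{i<j}$ denotes the submatrix of $A_i$ formed by its columns $i+1,\dots,d$ (in order), then the $d\times\frac{d(d-1)}{2}$ matrix $B(A_1,\dots,A_d)=[B_{1<j}\,B_{2<j}\,\dots\,B_{d-1<j}]$ has rank $d$. *)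

(* Defs.v *)
From HB Require Import structures.
From mathcomp Require Import all_boot all_order all_algebra.
Set Implicit Arguments.
Unset Strict Implicit.
Unset Printing Implicit Defensive.
Import GRing.Theory.
Local Open Scope ring_scope.

(* Indices run over 0, ..., d.-1 instead of 1, ..., d. *)

Lemma later_col_subproof (d : nat) (i : 'I_d) (k : 'I_(d - i.+1)) :
  (i.+1 + k < d)%N.
Proof. by rewrite -ltn_subRL. Qed.

Definition later_col (d : nat) (i : 'I_d) (k : 'I_(d - i.+1)) : 'I_d :=
  Ordinal (later_col_subproof k).

(* B_{i<j}: the columns of A i with index greater than i, in order. *)
Definition quad_block (K : fieldType) (d : nat) (A : 'I_d -> 'M[K]_d)
    (i : 'I_d) : 'M[K]_(d, d - i.+1) :=
  colsub (@later_col d i) (A i).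

(* B(A_1, ..., A_d): the blocks of all indices but the last, side by side. *)
Definition quad_matrix (K : fieldType) (d : nat) (A : 'I_d -> 'M[K]_d) :
    'M[K]_(d, \sum_(i < d.-1) (d - i.+1)) :=
  \mxrow_(i < d.-1) quad_block A (widen_ord (leq_pred d) i).

Lemma quad_matrix_width (d : nat) :
  (\sum_(i < d.-1) (d - i.+1))%N = ((d * d.-1) %/ 2)%N.
Proof.
case: d => [|n]; first by rewrite big_ord0.
rewrite divn2 -bin2 -bin2_sum big_mkord big_ord_recl add0n /=.
rewrite (reindex_inj rev_ord_inj); apply: eq_bigr => i _ /=.
by rewrite /bump /= subSS subKn.
Qed.

Record quadratic_family (K : fieldType) (d : nat) (A : 'I_d -> 'M[K]_d) :
    Prop := QuadraticFamily {
  quad_skew : forall i, (A i)^T = - A i;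
  quad_col_diag : forall i, col i (A i) = 0;
  quad_col_anti : forall i j : 'I_d, (i < j)%N -> col j (A i) = - col i (A j);
  quad_rank : \rank (quad_matrix A) = d
}.

(* Main.v *)
Require Import Defs.
From HB Require Import structures.
From mathcomp Require Import all_boot all_order all_algebra.
From mathcomp Require Import zify ring.
Set Implicit Arguments.
Unset Strict Implicit.
Unset Printing Implicit Defensive.
Import GRing.Theory.
Local Open Scope ring_scope.

(** A d-quadratic family is the coordinate form of an alternating trilinear
form c on K^d, via (A_i)_(k,j) = c(i,k,j), and the rank condition says that c
has trivial radical. Given a system of three-point lines on the basis such that
every point r lies on a line {i, r, j} which is the only line through i and j,
the sum of the forms e_i /\ e_r /\ e_j over the lines has trivial radical. For
d odd, take all lines {0, 2t+1, 2t+2}; for d even, d >= 6, take this system on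
the first d - 3 points together with one more line on the last three. *)

Section LineForm.

Variable K : fieldType.

Definition order_sign (i j : nat) : K :=
  if (i < j)%N then 1 else if (j < i)%N then -1 else 0.

Lemma order_signC i j : order_sign j i = - order_sign i j.
Proof. by rewrite /order_sign; case: ltngtP; rewrite ?opprK ?oppr0. Qed.

Lemma order_sign_diag i : order_sign i i = 0.
Proof. by rewrite /order_sign ltnn. Qed.

Lemma order_sign_neq0 i j : i != j -> order_sign i j != 0.
Proof. by rewrite /order_sign; case: ltngtP; rewrite ?oppr_eq0 ?oner_neq0. Qed.

Variables (d : nat) (line : nat -> nat -> nat -> bool).

(** The product of signs is alternating and vanishes on repeated indices, so [line] need only be
    symmetric and its values on degenerate triples do not matter. *)
Definition line_form (i j k : nat) : K :=
  order_sign i j * order_sign j k * order_sign k i * (line i j k)%:R.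

Definition line_family (i : 'I_d) : 'M[K]_d := \matrix_(k, j) line_form i k j.

Lemma mul_quad_matrix_eq0 (A : 'I_d -> 'M[K]_d) (v : 'rV_d) (i j : 'I_d) :
  v *m quad_matrix A = 0 -> (i < j)%N -> (v *m A i) 0 j = 0.
Proof.
move=> vA0 lt_ij.
have lt_id : (i < d.-1)%N by have := ltn_ord j; lia.
(* Block [i] starts at column [i.+1] of [A i], so column [j] sits there at position [j - i.+1]. *)
have lt_jd : (j - i.+1 < d - i.+1)%N by have := ltn_ord j; lia.
have := congr1 (fun M => submxrow M (Ordinal lt_id)) vA0.
rewrite /quad_matrix mul_mxrow mxrowK => /matrixP/(_ 0 (Ordinal lt_jd)).
rewrite !mxE => v0; rewrite -[RHS]v0; apply: eq_bigr => k _.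
by rewrite /quad_block !mxE; congr (_ * A _ k _); apply: val_inj => //=; lia.
Qed.

Hypothesis lineCl : forall i j k, line i j k = line j i k.
Hypothesis lineCr : forall i j k, line i j k = line i k j.

Lemma line_formCl i j k : line_form j i k = - line_form i j k.
Proof.
rewrite /line_form lineCl (order_signC i j) (order_signC k i) (order_signC j k).
ring.
Qed.

Lemma line_formCr i j k : line_form i k j = - line_form i j k.
Proof.
rewrite /line_form lineCr (order_signC i j) (order_signC k i) (order_signC j k).
ring.
Qed.

Hypothesis line_cover : forall r, (r < d)%N -> exists i j,
  [/\ (i < j < d)%N, r != i, r != j, line i r j &
      forall k, (k < d)%N -> k != i -> k != j -> line i k j -> k = r].

Lemma line_family_quadratic : quadratic_family line_family.
Proof.
split.
- by move=> i; apply/matrixP => k j; rewrite !mxE line_formCr.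
- move=> i; apply/matrixP => k j; rewrite !mxE /line_form.
  by rewrite order_sign_diag mulr0 mul0r.
- move=> i j _; apply/matrixP => k l; rewrite !mxE.
  by rewrite line_formCr line_formCl line_formCr opprK.
apply/eqP; rewrite -[_ == _]/(row_free _); apply: inj_row_free => v v0.
apply/rowP => r; rewrite mxE.
have [i [j [/andP[lt_ij lt_jd] r_i r_j line_irj uniq_r]]] :=
  line_cover (ltn_ord r).
have lt_id := ltn_trans lt_ij lt_jd.
(* By uniqueness of the line, column [j] of the [i]-th matrix is nonzero only in row [r], where it
   is a product of signs; pairing it with [v] isolates [v 0 r]. *)
have := mul_quad_matrix_eq0 (i := Ordinal lt_id) (j := Ordinal lt_jd) v0 lt_ij.
rewrite mxE (bigD1 r) //= big1 ?addr0 => [|k k_r]; last first.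
  rewrite mxE /line_form /=.
  have [->|k_i] := eqVneq (k : nat) i; first by rewrite order_sign_diag; ring.
  have [->|k_j] := eqVneq (k : nat) j; first by rewrite order_sign_diag; ring.
  case: (boolP (line i k j)) => [/(uniq_r k (ltn_ord k) k_i k_j) k_eq|_].
    by rewrite (val_inj k_eq) eqxx in k_r.
  by rewrite !mulr0.
rewrite mxE /line_form /= line_irj mulr1 => /eqP.
rewrite eq_sym in r_i; have j_i : j != i by rewrite gtn_eqF.
rewrite !mulf_eq0 (negPf (order_sign_neq0 r_i)) (negPf (order_sign_neq0 r_j)).
by rewrite (negPf (order_sign_neq0 j_i)) !orbF => /eqP.
Qed.

End LineForm.

(* For distinct i, j, k this says that {i, j, k} = {0, 2t+1, 2t+2}. *)
Definition pencil_line (i j k : nat) : bool :=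
  ((i == 0) || (j == 0) || (k == 0))%N &&
  ((uphalf i == uphalf j) || (uphalf j == uphalf k) || (uphalf i == uphalf k)).

Definition split_line (m i j k : nat) : bool :=
  [&& m <= i, m <= j & m <= k]%N
  || [&& i < m, j < m, k < m & pencil_line i j k]%N.

Lemma split_lineCl m i j k : split_line m i j k = split_line m j i k.
Proof. by rewrite /split_line /pencil_line; lia. Qed.

Lemma split_lineCr m i j k : split_line m i j k = split_line m i k j.
Proof. by rewrite /split_line /pencil_line; lia. Qed.

Lemma split_line_cover m d r : odd m -> (2 < m)%N -> d = m \/ d = (m + 3)%N ->
  (r < d)%N -> exists i j,
  [/\ (i < j < d)%N, r != i, r != j, split_line m i r j &
      forall k, (k < d)%N -> k != i -> k != j -> split_line m i k j -> k = r].
Proof.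
move=> odd_m m_gt2 d_def lt_rd.
have [->|r_gt0] := posnP r.
  exists 1%N, 2%N; rewrite /split_line /pencil_line.
  by split; [lia..|move=> k; lia].
have [lt_rm|le_mr] := ltnP r m.
  (* The second witness is the partner of [r] in its pair [2t+1], [2t+2]; it stays below [m] because
     [m] is odd. *)
  exists 0%N, (if odd r then r.+1 else r.-1).
  case: ifP => odd_r; rewrite /split_line /pencil_line;
    by split; [lia..|move=> k; lia].
(* Here [d = m + 3]; the witnesses are the two other points of the extra line, in increasing
   order. *)
exists (if r == m then m.+1 else m), (if r == m.+2 then m.+1 else m.+2).
case: (eqVneq r m) => [r_m|r_m]; case: (eqVneq r m.+2) => [r_m2|r_m2];
  rewrite /split_line /pencil_line; by split; [lia..|move=> k; lia].
Qed.

Theorem proposition12 (K : fieldType) (charK : [pchar K] =i pred0)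
    (d : nat) (d_ge2 : (2 <= d)%N) (d_neq2 : d <> 2%N) (d_neq4 : d <> 4%N) :
  exists A : 'I_d -> 'M[K]_d, quadratic_family A.
Proof.
(* An even [d] other than 2 and 4 is at least 6, so [m] is always odd and at least 3. *)
pose m := if odd d then d else (d - 3)%N.
exists (line_family K (split_line m)).
apply: line_family_quadratic => [i j k|i j k|r].
- exact: split_lineCl.
- exact: split_lineCr.
by apply: split_line_cover; rewrite /m; case: ifP; lia.
Qed.
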